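(* Fix $h\ge2$ and let $P$ be a probability measure on directed graphs $G$ on $n$ vertices satisfying $$\mathbb E_P\Big[\sum_{v}\deg_{\mathrm{in}}(v)^{h-1}\Big]=m_{\mathrm{in}},\qquad \mathbb E_P\Big[\sum_{v}\deg_{\mathrm{out}}(v)^{h-1}\Big]=m_{\mathrm{out}}.$$ Then for every directed tree $T$ on $h$ vertices, $$\mathbb E_P[\hom(T,G)]\;\le\;\max\{m_{\mathrm{in}},m_{\mathrm{out}}\}.$$
   Context: A digraph (directed graph) is a finite directed simple loopless graph: at most one arc for each ordered pair of distinct vertices (opposite arcs are allowed). A directed tree is an orientation of a finite undirected tree. $\hom(T,G)$ is the number of digraph homomorphisms $T\to G$ (maps $V(T)\to V(G)$ sending arcs to arcs, preserving direction). $\deg_{\mathrm{in}}(v),\deg_{\mathrm{out}}(v)$ are the in- and out-degree of $v$ in $G$, and the sums run over all $n$ vertices of $G$. *)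

(* Defs.v *)
From HB Require Import structures.
From mathcomp Require Import all_boot all_order all_algebra.
From mathcomp Require Import all_classical all_reals all_analysis.
Set Implicit Arguments.
Unset Strict Implicit.
Unset Printing Implicit Defensive.

(* A digraph is its set of arcs; opposite arcs are allowed, loops are not. *)
Record digraph (V : finType) := Digraph {
  arcs : {set V * V};
  arcs_loopless : [forall v, (v, v) \notin arcs]
}.

HB.instance Definition _ (V : finType) := [isSub for @arcs V].
HB.instance Definition _ (V : finType) := [Finite of digraph V by <:].

Definition is_arc (V : finType) (G : digraph V) : rel V :=
  fun u v => (u, v) \in arcs G.

Lemma no_arcs_loopless (V : finType) :
  [forall v : V, (v, v) \notin (finset.set0 : {set V * V})].
Proof. by apply/forallP => v; rewrite inE. Qed.

Definition empty_digraph (V : finType) : digraph V :=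
  Digraph (no_arcs_loopless V).

(* The finite type of digraphs on V carries the discrete sigma-algebra. *)
HB.instance Definition _ (V : finType) :=
  isPointed.Build (digraph V) (empty_digraph V).
HB.instance Definition _ (V : finType) :=
  @isMeasurable.Build default_measure_display (digraph V)
    discrete_measurable discrete_measurable0
    discrete_measurableC discrete_measurableU.

Definition indeg (V : finType) (G : digraph V) (v : V) : nat :=
  #|[set u | is_arc G u v]|.

Definition outdeg (V : finType) (G : digraph V) (v : V) : nat :=
  #|[set u | is_arc G v u]|.

Definition is_hom (W V : finType) (T : digraph W) (G : digraph V)
    (f : {ffun W -> V}) : bool :=
  [forall x, forall y, is_arc T x y ==> is_arc G (f x) (f y)].

Definition num_hom (W V : finType) (T : digraph W) (G : digraph V) : nat :=
  #|[set f : {ffun W -> V} | is_hom T G f]|.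

(* An undirected simple graph is a symmetric irreflexive relation. Since
   [ucycle e [:: x; y]] holds as soon as xy is an edge, only simple cycles
   with at least three vertices are excluded. *)
Definition is_tree (V : finType) (e : rel V) : Prop :=
  [/\ symmetric e, irreflexive e, 0 < #|V|,
      forall x y, connect e x y
    & forall c : seq V, ucycle e c -> size c <= 2].

(* T is an orientation of e: each edge of e is given exactly one direction. *)
Definition is_orientation (V : finType) (e : rel V) (T : digraph V) : Prop :=
  (forall x y, e x y = is_arc T x y || is_arc T y x) /\
  (forall x y, ~~ (is_arc T x y && is_arc T y x)).

Definition directed_tree (V : finType) (T : digraph V) : Prop :=
  exists2 e : rel V, is_tree e & is_orientation e T.

(* Main.v *)
Require Import Defs.
From mathcomp Require Import all_boot all_order all_algebra.
From mathcomp Require Import all_classical all_reals all_analysis.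
From mathcomp Require Import measurable_realfun lra zify.
Import Order.TTheory GRing.Theory Num.Theory.
Local Open Scope ring_scope.

(** The comparison has to hold before the maximum is taken, graph by graph and
    with the same coefficients for every graph: for some [lam] in [0, 1] that
    depends on the tree [T] only,
<<
  hom(T, G) <= lam * \sum_v outdeg(v)^(h-1) + (1 - lam) * \sum_v indeg(v)^(h-1).
>>
    Taking expectations then gives a convex combination of [m_out] and [m_in],
    which is at most their maximum ([num_hom_bound], [expectation_le_comb]).

    To get this inequality, orient the edges of [T] away from a root [r]. A map
    [f : T -> G] can be built by a random walk along the tree: choose [f r],
    then for every child [w] of [v] choose [f w] uniformly among the
    neighbours of [f v] on the side prescribed by the arc between [v] and [w].
    If [a v w] denotes the number of these neighbours, then [f] is reached from
    [f r] with probability [1 / F_r f], where [F_r f] is the product of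
    [a (parent w) w] over [w <> r]. Hence the sum of [phi (f r) / F_r f] over
    all homomorphisms [f] is at most [\sum_x phi x] ([tree_kernel]).

    Use it with [phi = deg^(h-1)], for each root [v] and each direction in which
    an edge [vw] can leave [v]. It remains to find weights [c v w] on the
    oriented edges, of total 1, such that for each homomorphism
<<
  1 <= \sum_(v, w) c v w * a v w ^ (h-1) / F_v f.
>>
    By the weighted AM-GM inequality this follows once the weighted geometric
    mean of the terms is 1 ([edge_weight_amgm]). Suppose that a random root [s]
    of law [p] satisfies
<<
  E[number of children of v] = (h - 1) * p v   for every v,
>>
    and let [c v w] be the probability, divided by [h - 1], that [v] is the
    parent of [w]. Then [c v w] sums over [w] to [p v], so that both
    [\prod (a v w)^((h-1) * c v w)] and [\prod (F_v f)^(c v w)] are equal to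
    [\prod_s (F_s f)^(p s)]. A vertex [v] of degree [d] has [d - 1] children, and
    one more when it is the root; so the condition on [p] says
    [d - 1 + p v = (h - 1) * p v], which is solved by [p v = (d - 1) / (h - 2)]
    ([root_distribution]). *)

(** * Rooted trees *)

(** [depth] strictly decreases from child to parent, which rules out cyclic
    parenthood; the second clause says that no edge of [e] is outside of the
    parent relation. The value [par r] is arbitrary. *)
Definition rooting {W : finType} (e : rel W) (r : W)
    (par : W -> W) (depth : W -> nat) : Prop :=
  (forall w, w != r -> e (par w) w /\ (depth (par w) < depth w)%N) /\
  (forall u v, e u v -> (v != r /\ par v = u) \/ (u != r /\ par u = v)).

(** Breadth-first search: a vertex other than [r] has a neighbour that is
    strictly closer to [r], namely the second vertex of a shortest path. *)
Lemma connected_parent {W : finType} (e : rel W) (r : W) :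
  symmetric e -> (forall x y, connect e x y) ->
  exists par depth, forall w, w != r ->
    e (par w) w /\ (depth (par w) < depth w)%N.
Proof.
move=> e_sym e_conn.
pose reach w k := [exists p : k.-tuple W, path e w p && (last w p == r)].
have reachP w : exists k, reach w k.
  have /connectP[p pP rE] := e_conn w r.
  by exists (size p); apply/existsP; exists (in_tuple p); rewrite pP -rE /=.
pose depth w := ex_minn (reachP w).
have step w : exists y, w != r -> e y w /\ (depth y < depth w)%N.
  have [->|wr] := eqVneq w r; first by exists r.
  rewrite {2}/depth; case: ex_minnP => k /existsP[[p szp] /= /andP[pP lP]] _.
  case: p szp pP lP => [|y p] /= szp; first by rewrite (negbTE wr).
  move=> /andP[ewy yp] lp; exists y => _; split; first by rewrite e_sym.
  rewrite -(eqP szp) ltnS /depth; case: ex_minnP => m _; apply.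
  by apply/existsP; exists (in_tuple p); rewrite yp.
by have [par parP] := choice step; exists par, depth.
Qed.

(** An edge [uv] outside of the parent relation can be deleted without
    disconnecting the graph, since the parent edges still lead every vertex to
    [r]. A simple path from [u] to [v] in what remains would then close with
    [uv] into a cycle of length at least 3. *)
Lemma tree_rooting {W : finType} (e : rel W) (r : W) :
  is_tree e -> exists par depth, rooting e r par depth.
Proof.
case=> e_sym e_irr _ e_conn e_acyc.
have [par [depth parP]] := connected_parent e r e_sym e_conn.
exists par, depth; split=> // u v euv.
apply: contrapT => /not_orP[nvu nuv].
pose e' : rel W := [rel x y | [&& e x y, (x, y) != (u, v) & (x, y) != (v, u)]].
have e'_sym : symmetric e'.
  by move=> x y; rewrite /e' /= e_sym !xpair_eqE;
    do ![case: eqP => _ //=]; rewrite ?andbF.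
have e'_conn w : connect e' w r.
  have [n] := ubnP (depth w); elim: n w => // n IHn w le_wn.
  have [->|wr] := eqVneq w r; first exact: connect0.
  have [epw ltpw] := parP w wr.
  apply: connect_trans (IHn (par w) (leq_trans ltpw _)) => //.
  apply: connect1; rewrite e'_sym /e' /= epw /= !xpair_eqE.
  apply/andP; split; apply/negP => /andP[/eqP pE /eqP wE].
    by apply: nvu; rewrite -wE.
  by apply: nuv; rewrite -wE.
have /connectP[p0] : connect e' u v.
  by rewrite (connect_trans (e'_conn u)) // (sym_connect_sym e'_sym).
case/shortenP => p pP up _ vE.
have pe : path e u p by apply: sub_path pP => x y /= /and3P[].
have : ucycle e (u :: p).
  by rewrite /ucycle up andbT /cycle rcons_path pe -vE e_sym.
move=> /e_acyc; case: p vE pP {up pe} => [|y [|z p]] //= vE.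
  by move: euv; rewrite vE e_irr.
by rewrite /e' /= vE eqxx andbF.
Qed.

(** * A balanced law for the root *)

(** Every neighbour of [v] is a child of [v], except the parent that [v] has
    when it is not the root. *)
Lemma rooting_degree {W : finType} (e : rel W) (r : W) par depth (v : W) :
  symmetric e -> rooting e r par depth ->
  (#|[set w | (w != r) && (par w == v)]| + (v != r))%N = #|[set w | e v w]|.
Proof.
move=> e_sym [parP edgeP].
have [->|vr] := eqVneq v r.
  rewrite addn0; apply: eq_card => w; rewrite !inE.
  apply/andP/idP => [[wr /eqP pw]|erw]; first by rewrite -pw; case: (parP w wr).
  by have [[? ->]|[]] := edgeP _ _ erw; rewrite ?eqxx.
rewrite addnC [RHS](cardsD1 (par v)).
have [epv ltpv] := parP v vr.
rewrite inE e_sym epv; congr (_ + _)%N; apply: eq_card => w; rewrite !inE.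
apply/andP/andP => [[wr /eqP pw]|[wpv evw]].
  have [] := parP w wr; rewrite pw => -> ltw; split=> //.
  by apply: contraTneq ltw => ->; rewrite -leqNgt ltnW.
have [[? ->]|[_ pv]] := edgeP _ _ evw; first by rewrite eqxx.
by rewrite pv eqxx in wpv.
Qed.

Lemma sum_children {W : finType} (r : W) (par : W -> W) :
  (\sum_v #|[set w | (w != r) && (par w == v)]|)%N = #|W|.-1.
Proof.
rewrite -(cardC1 r) -[RHS]sum1_card [RHS](partition_big par xpredT) //=.
by apply: eq_bigr => v _; rewrite -sum1_card; apply: eq_bigl => w; rewrite !inE.
Qed.

(** With [d v] the degree of [v], [p v = (d v - 1) / (#|W| - 2)] works, for the
    expected number of children of [v] is [d v - 1 + p v]. The total is 1 because
    [\sum_v (d v - 1) = #|W| - 2], as one sees by counting the vertices other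
    than a fixed root by their parent. A single edge leaves a denominator of 0,
    but there [d v - 1 = 0] and any law of the root is balanced. *)
Lemma root_distribution (R : realType) {W : finType} (e : rel W)
    (par : W -> W -> W) (depth : W -> W -> nat) :
  symmetric e -> (2 <= #|W|)%N ->
  (forall r, rooting e r (par r) (depth r)) ->
  exists p : W -> R, [/\ forall s, 0 <= p s, \sum_s p s = 1 &
    forall v, \sum_s p s * #|[set w | (w != s) && (par s w == v)]|%:R
      = p v * (#|W|.-1)%:R].
Proof.
move=> e_sym W2 rootP; pose d v := #|[set w | e v w]|.
pose ch s v := #|[set w | (w != s) && (par s w == v)]|.
have degE s v : (ch s v + (v != s))%N = d v by apply: rooting_degree.
have chE s v : (ch s v)%:R = (d v)%:R - 1 + (v == s)%:R :> R.
  by rewrite -(degE s v) natrD; case: (v == s) => /=; lra.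
have balance (p : W -> R) v : \sum_s p s = 1 ->
    \sum_s p s * (ch s v)%:R = (d v)%:R - 1 + p v.
  move=> p1; under eq_bigr => s _ do rewrite chE mulrDr.
  rewrite big_split /= -mulr_suml p1 mul1r; congr (_ + _).
  rewrite (bigD1 v) //= eqxx mulr1 big1 ?addr0 // => s sv.
  by rewrite eq_sym (negbTE sv) mulr0.
have [r _] : exists r : W, r \in W by apply/card_gt0P; apply: ltn_trans W2.
have dsum : \sum_v ((d v)%:R - 1) = (#|W|.-2)%:R :> R.
  have : \sum_v (ch r v)%:R = (#|W|.-1)%:R :> R.
    by rewrite -natr_sum sum_children.
  under eq_bigr => v _ do rewrite chE.
  rewrite big_split /= [X in _ + X](bigD1 r) //= eqxx [X in 1 + X]big1;
    last by move=> v /negbTE ->.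
  case: #|W| W2 => [|[|k]] //= _; rewrite addr0 -[k.+1%:R]natr1 => /eqP.
  by rewrite (inj_eq (addIr _)) => /eqP.
have d_ge1 v : 1 <= (d v)%:R :> R.
  rewrite ler1n; have [w vw] : exists w, v != w.
    apply/existsP; apply: contraTT W2; rewrite negb_exists => /forallP Wv.
    rewrite -leqNgt -(card1 v); apply/subset_leq_card/fintype.subsetP => w _.
    by rewrite inE eq_sym; move: (Wv w); rewrite negbK.
  by rewrite -(degE w v) vw addn1.
have [W_eq2|W_neq2] := eqVneq #|W| 2.
  exists (fun=> 2^-1).
  have p1 : \sum_(s : W) 2^-1 = 1 :> R by rewrite sumr_const W_eq2; lra.
  split=> [s||v] //.
  rewrite balance // W_eq2 /= mulr1 -[RHS]add0r; congr (_ + _).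
  apply: (@psumr_eq0P _ _ xpredT (fun v => (d v)%:R - 1)) => //.
    by move=> u _; rewrite subr_ge0.
  by rewrite dsum W_eq2.
have W3 : (0 < #|W|.-2)%N by move: W2 W_neq2; lia.
exists (fun s => ((d s)%:R - 1) / (#|W|.-2)%:R).
have p1 : \sum_s (((d s)%:R - 1) / (#|W|.-2)%:R) = 1 :> R.
  by rewrite -mulr_suml dsum mulfV // pnatr_eq0 -lt0n.
split=> // [s|v]; first by rewrite divr_ge0 // subr_ge0.
rewrite balance //; have -> : (#|W|.-1)%:R = (#|W|.-2)%:R + 1 :> R.
  by rewrite natr1; congr (_%:R); move: W3; lia.
by rewrite mulrDr mulr1 divfK // pnatr_eq0 -lt0n.
Qed.

(** * Tree-indexed random walks *)

Definition upd {W V : finType} (f : {ffun W -> V}) (w : W) (b : V) :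
    {ffun W -> V} := [ffun u => if u == w then b else f u].

(** Exchanging the new value [b] with the old value [f w] is an involution on
    the pairs [(f, b)]. *)
Lemma resample_sum {R : realType} {W V : finType} (w : W)
    (Psi : {ffun W -> V} -> R) :
  \sum_f \sum_b Psi (upd f w b) = #|V|%:R * \sum_f Psi f.
Proof.
rewrite pair_bigA /=.
pose swap (x : {ffun W -> V} * V) := (upd x.1 w x.2, x.1 w).
have swapK : involutive swap.
  case=> f b; congr (_, _); last by rewrite /= ffunE eqxx.
  by apply/ffunP => u; rewrite !ffunE; case: eqVneq => // ->.
rewrite (reindex_inj (inv_inj swapK)) /=.
rewrite (eq_bigr (fun x => Psi x.1)) => [|[f b] _].
  rewrite -(pair_bigA _ (fun f _ => Psi f)) /= mulr_sumr.
  by apply: eq_bigr => f _; rewrite sumr_const mulr_natl.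
by congr Psi; apply/ffunP => u; rewrite !ffunE; case: eqVneq => [->|].
Qed.

(** The vertices of [s] are listed children first, so that the head [w] of the
    list occurs in no other factor: averaging over the value at [w] then removes
    the factor of [w], as [g w] is substochastic. Instead of shrinking the domain
    of [f], each removed vertex is left with a free value, which explains the
    powers of [#|V|]. *)
Lemma tree_kernel_partial {R : realType} {W V : finType} (r : W) (par : W -> W)
    (phi : V -> R) (g : W -> V -> V -> R) (s : seq W) :
  (forall a, 0 <= phi a) -> (forall w a b, 0 <= g w a b) ->
  (forall w a, \sum_b g w a b <= 1) ->
  uniq s -> r \notin s -> all (fun w => par w != w) s ->
  pairwise (fun w u => par u != w) s ->
  #|V|%:R ^+ size s *
    (\sum_(f : {ffun W -> V}) phi (f r) * \prod_(w <- s) g w (f (par w)) (f w))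
  <= \sum_(f : {ffun W -> V}) phi (f r).
Proof.
move=> phi0 g0 g1.
elim: s => [|w s IHs] /=.
  move=> *; rewrite expr0 mul1r; apply: ler_sum => f _.
  by rewrite big_nil mulr1.
move=> /andP[ws us] /[!inE] /norP[rw rs] /andP[pw ps] /andP[/allP wpar pairs].
apply: le_trans (IHs us rs ps pairs).
rewrite exprSr -mulrA ler_wpM2l ?exprn_ge0 //.
rewrite -(resample_sum w); apply: ler_sum => f _.
have upd_off b u : u != w -> upd f w b u = f u by rewrite ffunE => /negbTE ->.
have upd_w b : upd f w b w = b by rewrite ffunE eqxx.
rewrite (eq_bigr (fun b => (phi (f r) *
   \prod_(u <- s) g u (f (par u)) (f u)) * g w (f (par w)) b)) => [|b _].
  rewrite -mulr_sumr -[leRHS]mulr1 ler_wpM2l //.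
  by rewrite mulr_ge0 // prodr_ge0.
rewrite big_cons upd_w (upd_off b r) // (upd_off b (par w)) //.
rewrite [g w _ _ * _]mulrC mulrA; congr (_ * _ * _).
rewrite big_seq_cond [RHS]big_seq_cond.
apply: eq_bigr => u /andP[us' _]; rewrite !upd_off //.
  by apply: contraNneq ws => <-.
exact: wpar.
Qed.

(** A random walk along the tree started with mass [phi] at the root, and moving
    to each child [w] by the substochastic kernel [g w], does not gain mass. *)
Lemma tree_kernel {R : realType} {W V : finType} (e : rel W) (r : W) par depth
    (phi : V -> R) (g : W -> V -> V -> R) :
  rooting e r par depth ->
  (forall a, 0 <= phi a) -> (forall w a b, 0 <= g w a b) ->
  (forall w a, \sum_b g w a b <= 1) ->
  \sum_(f : {ffun W -> V}) phi (f r) * \prod_(w | w != r) g w (f (par w)) (f w)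
  <= \sum_a phi a.
Proof.
move=> [parP _] phi0 g0 g1.
have [V0|V_gt0] := posnP #|V|.
  rewrite big1 ?sumr_ge0 // => f _.
  by have := max_card (pred1 (f r)); rewrite V0 card1.
pose ge_depth w u := (depth u <= depth w)%N.
pose s := sort ge_depth [seq w <- enum W | w != r].
have s_mem w : (w \in s) = (w != r).
  by rewrite mem_sort mem_filter mem_enum andbT.
have s_perm : perm_eq s [seq w <- enum W | w != r] by rewrite perm_sort.
have s_size : size s = #|W|.-1.
  rewrite (perm_size s_perm) size_filter -(cardC1 r) -sum1_card -sum1_count.
  exact: big_enum_cond.
have prodE (f : {ffun W -> V}) : \prod_(w | w != r) g w (f (par w)) (f w) =
    \prod_(w <- s) g w (f (par w)) (f w).
  by rewrite (perm_big _ s_perm) /= big_filter big_enum_cond.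
have totalE : \sum_(f : {ffun W -> V}) phi (f r) =
    #|V|%:R ^+ size s * \sum_a phi a.
  pose F w a := if w == r then phi a else 1.
  transitivity (\sum_(f : {ffun W -> V}) \prod_w F w (f w)).
    apply: eq_bigr => f _; rewrite (bigD1 r) //= /F eqxx big1 ?mulr1 //.
    by move=> w /negbTE ->.
  rewrite -bigA_distr_bigA (bigD1 r) //= /F eqxx mulrC; congr (_ * _).
  rewrite (eq_bigr (fun=> #|V|%:R)) => [|w /negbTE ->].
    by rewrite prodr_const s_size cardC1.
  by rewrite sumr_const.
under eq_bigr => f _ do rewrite prodE.
have Vs_gt0 : 0 < #|V|%:R ^+ size s :> R by rewrite exprn_gt0 // ltr0n.
rewrite -(ler_pM2l Vs_gt0) -totalE; apply: tree_kernel_partial => //.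
- by rewrite sort_uniq filter_uniq // enum_uniq.
- by rewrite s_mem eqxx.
- apply/allP => w; rewrite s_mem => /parP[_]; apply: contraTneq => ->.
  by rewrite ltnn.
(* Decreasing depth puts every child before its parent. *)
have : pairwise ge_depth s.
  rewrite -sorted_pairwise;
    last by move=> y x z /= xy yz; apply: leq_trans yz xy.
  by apply: sort_sorted => x y; apply: leq_total.
apply: (@sub_in_pairwise _ (mem s)); last by apply/allP.
move=> w u _ us; rewrite /ge_depth => le_uw; apply: contraTneq le_uw => <-.
by rewrite -ltnNge; move: (us : u \in s); rewrite s_mem => /parP[].
Qed.

(** * Counting maps from a tree *)

Section EdgeWeights.
Context {R : realType} {W : finType} (e : rel W).
Context (par : W -> W -> W) (depth : W -> W -> nat) (p : W -> R).
Context (rootP : forall r, rooting e r (par r) (depth r)).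
Context (W_gt1 : (1 < #|W|)%N).
Context (p_ge0 : forall s, 0 <= p s).
Context (p_sum : \sum_s p s = 1).
Context (p_balance : forall v,
  \sum_s p s * #|[set w | (w != s) && (par s w == v)]|%:R
    = p v * (#|W|.-1)%:R).

Let N := #|W|.-1.

(** The probability that a uniformly random vertex other than the random root
    [s] is [w] and has parent [v]. *)
Definition edge_weight (v w : W) : R :=
  (\sum_(s | (w != s) && (par s w == v)) p s) / N%:R.

Let N_neq0 : N%:R != 0 :> R.
Proof. by rewrite pnatr_eq0 -lt0n /N; case: #|W| W_gt1 => [|[]]. Qed.

Lemma edge_weight_ge0 v w : 0 <= edge_weight v w.
Proof. by rewrite divr_ge0 // sumr_ge0. Qed.

(** Both sides are the expectation, over the random root, of the sum of [X] over
    all pairs of a parent and its child. *)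
Lemma edge_weight_sum (X : W -> W -> R) :
  N%:R * \sum_v \sum_(w | e v w) edge_weight v w * X v w =
  \sum_s p s * \sum_(w | w != s) X (par s w) w.
Proof.
rewrite mulr_sumr; under eq_bigr => v _.
  rewrite mulr_sumr.
  under eq_bigr => w _.
    rewrite mulrA [N%:R * _]mulrC divfK // mulr_suml.
    over.
  over.
rewrite pair_big_dep /= (exchange_big_dep xpredT) //=.
apply: eq_bigr => s _; rewrite mulr_sumr.
rewrite -(pair_big_dep xpredT
  (fun v w => e v w && ((w != s) && (par s w == v))) (fun v w => p s * X v w)).
rewrite (exchange_big_dep (fun w => w != s)) /=; last first.
  by move=> v w _ /and3P[].
apply: eq_bigr => w ws; rewrite (big_pred1 (par s w)) // => v.
rewrite ws /= eq_sym andbC; case: eqP => //= ->.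
by have [/(_ w ws)[]] := rootP s.
Qed.

(** The law [p] is balanced exactly so that the parent end of a random edge has
    the law of the root. *)
Lemma edge_weight_marginal (Y : W -> R) :
  \sum_v \sum_(w | e v w) edge_weight v w * Y v = \sum_v p v * Y v.
Proof.
apply: (mulfI N_neq0); rewrite (edge_weight_sum (fun v _ => Y v)).
transitivity (\sum_s \sum_v
    p s * (#|[set w | (w != s) && (par s w == v)]|%:R * Y v)).
  apply: eq_bigr => s _; rewrite -mulr_sumr; congr (_ * _).
  rewrite (partition_big (par s) xpredT) //=; apply: eq_bigr => v _.
  rewrite (eq_bigr (fun=> Y v)) => [|w /andP[_ /eqP ->] //].
  by rewrite sumr_const mulr_natl; congr (_ *+ _);
    apply: eq_card => w; rewrite !inE.
rewrite exchange_big /= mulr_sumr; apply: eq_bigr => v _.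
under eq_bigr => s _ do rewrite mulrA.
by rewrite -mulr_suml p_balance mulrAC mulrC mulrA.
Qed.

Lemma edge_weight_total : \sum_v \sum_(w | e v w) edge_weight v w = 1.
Proof.
have := edge_weight_marginal (fun=> 1).
under [in X in _ = X -> _]eq_bigr => v _ do rewrite mulr1.
rewrite p_sum => <-; apply: eq_bigr => v _; apply: eq_bigr => w _.
by rewrite mulr1.
Qed.

(** Weighted AM-GM in its tangent form [1 + ln x <= x]: the weights have total 1
    and the weighted logarithms cancel, [edge_weight_sum] turning those of the
    numerators, and [edge_weight_marginal] those of the denominators, into the
    same expectation over the random root. *)
Lemma edge_weight_amgm (a : W -> W -> R) :
  (forall v w, e v w -> 0 < a v w) ->
  1 <= \sum_v \sum_(w | e v w)
    edge_weight v w * (a v w ^+ N / \prod_(u | u != v) a (par v u) u).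
Proof.
move=> a_gt0.
have par_gt0 v u : u != v -> 0 < a (par v u) u.
  by move=> uv; apply: a_gt0; have [/(_ u uv)[]] := rootP v.
pose F v := \prod_(u | u != v) a (par v u) u.
have F_gt0 v : 0 < F v by apply: prodr_gt0 => u; apply: par_gt0.
pose lnF v := \sum_(u | u != v) ln (a (par v u) u).
have lnFE v : ln (F v) = lnF v.
  suff [] : 0 < F v /\ ln (F v) = lnF v by [].
  rewrite /F /lnF; elim/big_ind2 : _ => [|x lx y ly [x0 xE] [y0 yE]|u uv].
  - by rewrite ln1.
  - by rewrite mulr_gt0 // lnM ?posrE // xE yE.
  - by rewrite par_gt0.
have tangent v w : e v w ->
    1 + (N%:R * ln (a v w) - lnF v) <= a v w ^+ N / F v.
  move=> vw; have x_gt0 : 0 < a v w ^+ N / F v.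
    by rewrite divr_gt0 // exprn_gt0 // a_gt0.
  have -> : N%:R * ln (a v w) - lnF v = ln (a v w ^+ N / F v).
    by rewrite ln_div ?posrE ?exprn_gt0 ?a_gt0 // lnXn ?a_gt0 // lnFE mulr_natl.
  by have := expR_ge1Dx (ln (a v w ^+ N / F v)); rewrite lnK.
suff {1}<- : \sum_v \sum_(w | e v w)
    edge_weight v w * (1 + (N%:R * ln (a v w) - lnF v)) = 1.
  apply: ler_sum => v _; apply: ler_sum => w vw.
  by apply: ler_wpM2l; [apply: edge_weight_ge0 | apply: tangent].
under eq_bigr => v _.
  under eq_bigr => w _ do rewrite mulrDr mulr1 mulrBr mulrCA.
  rewrite big_split /= sumrB -mulr_sumr.
  over.
rewrite big_split /= edge_weight_total sumrB -mulr_sumr.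
rewrite edge_weight_sum edge_weight_marginal.
by rewrite subrr addr0.
Qed.

End EdgeWeights.

(** The constraint on an edge is an arbitrary relation that may vary with the
    edge and with its direction of traversal, which covers directed trees: an arc
    of the tree is followed forwards or backwards. *)
Lemma tree_map_bound (R : realType) {W : finType} (e : rel W) :
  is_tree e -> (1 < #|W|)%N ->
  exists c : W -> W -> R, [/\ forall v w, 0 <= c v w,
    \sum_v \sum_(w | e v w) c v w = 1 &
    forall (V : finType) (B : W -> W -> rel V),
      #|[set f : {ffun W -> V} |
          [forall v, forall w, e v w ==> B v w (f v) (f w)]]|%:R
      <= \sum_v \sum_(w | e v w)
           c v w * \sum_x #|[set y | B v w x y]|%:R ^+ #|W|.-1].
Proof.
move=> e_tree W2; have e_sym : symmetric e by case: e_tree.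
have [par par_ex] := choice (fun r => tree_rooting e r e_tree).
have [depth rootP] := choice par_ex.
have [p [p0 p1 pB]] := root_distribution R e par depth e_sym W2 rootP.
pose c := edge_weight par p; have c0 := edge_weight_ge0 par p p0.
exists c; split=> [||V B] //; first exact: edge_weight_total rootP W2 p1 pB.
pose deg v w x : R := #|[set y | B v w x y]|%:R.
pose F v (f : {ffun W -> V}) :=
  \prod_(u | u != v) deg (par v u) u (f (par v u)).
set H := [set f | _].
have HP f v w : f \in H -> e v w -> B v w (f v) (f w).
  by rewrite inE => /forallP/(_ v)/forallP/(_ w)/implyP.
have degB v w x y : B v w x y -> 0 < deg v w x.
  by move=> Bxy; rewrite ltr0n; apply/card_gt0P; exists y; rewrite inE.
(* Each map counts for 1, which the AM-GM inequality bounds. *)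
have count_le : #|H|%:R <= \sum_(f in H) \sum_v \sum_(w | e v w)
    c v w * (deg v w (f v) ^+ #|W|.-1 / F v f).
  rewrite -sum1_card natr_sum; apply: ler_sum => f fH.
  apply: (edge_weight_amgm _ _ _ _ rootP W2 p0 p1 pB
    (fun v w => deg v w (f v))).
  by move=> v w vw; apply: degB (HP f v w fH vw).
apply: (le_trans count_le); rewrite exchange_big; apply: ler_sum => v _.
rewrite exchange_big; apply: ler_sum => w vw; rewrite -mulr_sumr.
apply: ler_wpM2l => //.
(* A uniform step from [x]; it has mass 0 when [x] has no successor. *)
pose g u x y : R := (B (par v u) u x y)%:R / deg (par v u) u x.
have g0 u x y : 0 <= g u x y by rewrite divr_ge0.
have g1 u x : \sum_y g u x y <= 1.
  rewrite -mulr_suml -natr_sum.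
  have -> : (\sum_y B (par v u) u x y)%N = #|[set y | B (par v u) u x y]|.
    by rewrite -sum1_card [RHS]big_mkcond; apply: eq_bigr => y _;
      rewrite inE; case: (B _ _ _ _).
  rewrite /deg.
  have [->|dn0] := eqVneq (#|[set y | B (par v u) u x y]|%:R : R) 0.
    by rewrite mul0r.
  by rewrite divff.
pose phi x : R := deg v w x ^+ #|W|.-1.
have phi0 x : 0 <= phi x by rewrite exprn_ge0.
apply: le_trans (tree_kernel e v (par v) (depth v) phi g (rootP v) phi0 g0 g1).
(* Maps outside of [H] only add nonnegative terms to the walk. *)
rewrite [leRHS](bigID (mem H)) /= -[leLHS]addr0 lerD //; last first.
  by apply: sumr_ge0 => f _; rewrite mulr_ge0 // prodr_ge0.
apply: ler_sum => f fH; rewrite /phi /F -prodfV.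
apply: ler_wpM2l; first exact: exprn_ge0.
apply: ler_prod => u uv.
have [/(_ u uv)[epar _] _] := rootP v.
by rewrite invr_ge0 ler0n /g HP ?mul1r /=.
Qed.

(** * Directed trees and expectations *)

(** [lam] is the total weight of the edges that leave their parent end along an
    arc of [T]; these are the edges whose degree is an out-degree in [G]. *)
Lemma num_hom_bound (R : realType) {W : finType} (T : digraph W) :
  directed_tree T -> (1 < #|W|)%N ->
  exists2 lam : R, 0 <= lam <= 1 & forall (V : finType) (G : digraph V),
    (num_hom T G)%:R <=
      lam * \sum_v (outdeg G v)%:R ^+ #|W|.-1
      + (1 - lam) * \sum_v (indeg G v)%:R ^+ #|W|.-1.
Proof.
move=> [e e_tree [eE _]] W2.
have [c [c0 c1 cB]] := tree_map_bound R e e_tree W2.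
pose fwd := \sum_v \sum_(w | e v w && is_arc T v w) c v w.
pose bwd := \sum_v \sum_(w | e v w && ~~ is_arc T v w) c v w.
have split_sum : fwd + bwd = 1.
  rewrite -c1 -big_split; apply: eq_bigr => v _ /=.
  by rewrite [RHS](bigID (is_arc T v)).
have fwd0 : 0 <= fwd by apply: sumr_ge0 => v _; apply: sumr_ge0.
have bwd0 : 0 <= bwd by apply: sumr_ge0 => v _; apply: sumr_ge0.
exists fwd => [|V G]; first by rewrite fwd0 -split_sum lerDl.
have -> : 1 - fwd = bwd by rewrite -split_sum addrAC subrr add0r.
pose B v w x y := if is_arc T v w then is_arc G x y else is_arc G y x.
have hom_sub : (num_hom T G <= #|[set f : {ffun W -> V} |
    [forall v, forall w, e v w ==> B v w (f v) (f w)]]|)%N.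
  apply/subset_leq_card/fintype.subsetP => f; rewrite !inE => /forallP fhom.
  have arcP v w : is_arc T v w -> is_arc G (f v) (f w).
    by move: (fhom v) => /forallP/(_ w)/implyP.
  apply/forallP => v; apply/forallP => w; apply/implyP; rewrite eE /B.
  by case: ifP => [vw _|_ /=]; apply: arcP.
apply: le_trans (_ : _ <= _%:R) (le_trans (cB V B) _).
  by rewrite ler_nat.
rewrite /fwd /bwd !mulr_suml -big_split; apply: ler_sum => v _ /=.
rewrite (bigID (is_arc T v)) /= !mulr_suml lerD //;
  apply: ler_sum => w /andP[_ vw].
  by rewrite ler_wpM2l // ler_sum // => x _; rewrite /B vw.
by rewrite ler_wpM2l // ler_sum // => x _; rewrite /B (negbTE vw).
Qed.

(** Nonnegativity replaces integrability here, so the expectations may be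
    infinite. *)
Lemma expectation_le_comb {d : measure_display} {Omega : measurableType d}
    {R : realType} (P : probability Omega R) (X Y Z : Omega -> R) (lam mu : R) :
  measurable_fun setT X -> measurable_fun setT Y -> measurable_fun setT Z ->
  (forall w, 0 <= X w) -> (forall w, 0 <= Y w) -> (forall w, 0 <= Z w) ->
  0 <= lam -> 0 <= mu -> (forall w, X w <= lam * Y w + mu * Z w) ->
  ('E_P[X] <= lam%:E * 'E_P[Y] + mu%:E * 'E_P[Z])%E.
Proof.
move=> mX mY mZ X0 Y0 Z0 lam0 mu0 leX; rewrite unlock.
have mE (U : Omega -> R) : measurable_fun setT U ->
    measurable_fun setT (fun w => (U w)%:E : \bar R).
  by move=> mU; apply/measurable_EFinP.
rewrite -!ge0_integralZl //; try exact: mE; try by move=> w _; rewrite lee_fin.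
rewrite -ge0_integralD //.
- apply: ge0_le_integral => //.
  + by move=> w _; rewrite lee_fin.
  + exact: mE.
  + by apply: emeasurable_funD; apply: measurable_funeM; apply: mE.
  + by move=> w _; rewrite -!EFinM -EFinD lee_fin.
- by move=> w _; rewrite mule_ge0 // lee_fin.
- by apply: measurable_funeM; apply: mE.
- by move=> w _; rewrite mule_ge0 // lee_fin.
- by apply: measurable_funeM; apply: mE.
Qed.

Local Open Scope ereal_scope.

Theorem corollary5p5 (R : realType) (h n : nat) (hh : (2 <= h)%N)
  (P : probability (digraph 'I_n) R) (m_in m_out : R)
  (Hin : 'E_P[(fun G : digraph 'I_n =>
            \sum_(v < n) (indeg G v)%:R ^+ (h - 1))%R] = m_in%:E)
  (Hout : 'E_P[(fun G : digraph 'I_n =>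
            \sum_(v < n) (outdeg G v)%:R ^+ (h - 1))%R] = m_out%:E) :
  forall (W : finType) (T : digraph W), #|W| = h -> directed_tree T ->
    'E_P[(fun G : digraph 'I_n => (num_hom T G)%:R)%R] <= (Num.max m_in m_out)%:E.
Proof.
move=> W T Wh T_tree.
have W2 : (1 < #|W|)%N by rewrite Wh.
have [lam /andP[lam0 lam1] homB] := num_hom_bound R T T_tree W2.
rewrite Wh -subn1 in homB.
apply: (@le_trans _ _ (lam%:E * m_out%:E + (1 - lam)%R%:E * m_in%:E)).
  rewrite -Hin -Hout; apply: expectation_le_comb => //.
  - by move=> G; apply: sumr_ge0.
  - by move=> G; apply: sumr_ge0.
  - by rewrite subr_ge0.
  - exact: homB.
rewrite -!EFinM -EFinD lee_fin.
have le_in : (m_in <= Num.max m_in m_out)%R by rewrite le_max lexx.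
have le_out : (m_out <= Num.max m_in m_out)%R by rewrite le_max lexx orbT.
nra.
Qed.
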